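(* Let $K$ be a field, let $n,p,r$ be positive integers with $p\geq 4$, and let $T=\sum_{i=1}^r u_i\otimes v_i\otimes w_i\in K^{n\times n\times p}$ with $u_i,v_i\in K^n$, $w_i\in K^p$, with slices $T_1,\ldots,T_p$. Assume: 1. The vectors $w_1,\ldots,w_r$ are pairwise linearly independent. 2. The span $\langle T_1,\ldots,T_p\rangle$ contains an invertible matrix. 3. There is an invertible matrix $A\in\langle T_1,\ldots,T_p\rangle$ such that for every $l\in\{3,\ldots,p\}$ there exists $m\in\{3,\ldots,p\}$, $m\neq l$, for which the triple $(A^{-1}T_2,A^{-1}T_l,A^{-1}T_m)$ satisfies property $(H_r)$. Then $\mathrm{rank}(T)=r$, and the decomposition of $T$ as a sum of $r$ rank-one tensors is essentially unique.
   Context: For $u\in K^m,v\in K^n,w\in K^p$, $u\otimes v\otimes w$ is the tensor with entries $u_iv_jw_k$; rank one means $u,v,w\neq0$; the rank of a tensor is the least number of rank-one tensors summing to it. The slices of $T\in K^{m\times n\times p}$ are $T_k=(T_{ijk})_{i,j}$. Essentially unique means unique up to permutation of the rank-one terms. $[X,Y]=XY-YX$, $\mathrm{Im}$ denotes column space. A triple $(X,Y,W)$ of $n\times n$ matrices satisfies property $(H_r)$ if (i) $\mathrm{Im}[X,Y]$, $\mathrm{Im}[X,W]$, $\mathrm{Im}[Y,W]$ each have dimension $2(r-n)$, and (ii) $\mathrm{Im}[X,Y]+\mathrm{Im}[X,W]$, $\mathrm{Im}[Y,X]+\mathrm{Im}[Y,W]$, $\mathrm{Im}[W,X]+\mathrm{Im}[W,Y]$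 each have dimension $3(r-n)$. *)

(* Defs.v *)
From HB Require Import structures.
From mathcomp Require Import all_boot all_order all_fingroup all_algebra.

Set Implicit Arguments.
Unset Strict Implicit.
Unset Printing Implicit Defensive.

Import Order.TTheory GRing.Theory Num.Theory.
Local Open Scope ring_scope.

Notation tensor K m n p := {ffun 'I_m * 'I_n * 'I_p -> K}.

Section Tensors.
Variables (K : fieldType) (m n p : nat).

Definition outer (u : 'cV[K]_m) (v : 'cV[K]_n) (w : 'cV[K]_p) :
    tensor K m n p :=
  [ffun x => u x.1.1 0 * v x.1.2 0 * w x.2 0].

Definition slice (T : tensor K m n p) (k : 'I_p) : 'M[K]_(m, n) :=
  \matrix_(i, j) T (i, j, k).

Definition slice_span (T : tensor K m n p) : {vspace 'M[K]_(m, n)} :=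
  <<[seq slice T k | k : 'I_p]>>%VS.

Definition rank_one (t : tensor K m n p) : Prop :=
  exists (u : 'cV[K]_m) (v : 'cV[K]_n) (w : 'cV[K]_p),
    [/\ u != 0, v != 0, w != 0 & t = outer u v w].

Definition decomposition (T : tensor K m n p) (r : nat)
    (t : 'I_r -> tensor K m n p) : Prop :=
  (forall i, rank_one (t i)) /\ T = \sum_(i < r) t i.

Definition has_tensor_rank (T : tensor K m n p) (r : nat) : Prop :=
  (exists t : 'I_r -> tensor K m n p, decomposition T t) /\
  (forall s (t : 'I_s -> tensor K m n p), decomposition T t -> (r <= s)%N).

Definition essentially_unique_decomposition (T : tensor K m n p) (r : nat) :
    Prop :=
  exists2 t : 'I_r -> tensor K m n p, decomposition T t &
    forall t' : 'I_r -> tensor K m n p, decomposition T t' ->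
      exists s : 'S_r, forall i, t' i = t (s i).

End Tensors.

Section PropertyH.
Variables (K : fieldType) (n : nat).
Implicit Types X Y W : 'M[K]_n.

Definition mxcommutator X Y : 'M[K]_n := X *m Y - Y *m X.

(* Matrices denote row spaces in the scope %MS, so the column space of X is
   represented by its transpose. *)
Definition colspace X : 'M[K]_n := X^T.

(* The dimensions are compared in int: r - n is not truncated when r < n. *)
Definition propertyH (r : nat) X Y W : Prop :=
  let C := fun X Y => colspace (mxcommutator X Y) in
  let d := r%:Z - n%:Z in
  [/\ (\rank (C X Y))%:Z = 2 * d,
      (\rank (C X W))%:Z = 2 * d &
      (\rank (C Y W))%:Z = 2 * d] /\
  [/\ (\rank (C X Y + C X W)%MS)%:Z = 3 * d,
      (\rank (C Y X + C Y W)%MS)%:Z = 3 * d &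
      (\rank (C W X + C W Y)%MS)%:Z = 3 * d].

End PropertyH.

(* Indices are 0-based: the second slice has index 1, and the slices numbered
   3, ..., p are those with index at least 2. *)
Definition second_index (p : nat) (hp : (4 <= p)%N) : 'I_p :=
  Ordinal (leq_trans (isT : (1 < 4)%N) hp).

(* Main.v *)
Require Import Defs.
From HB Require Import structures.
From mathcomp Require Import all_boot all_order all_fingroup all_algebra.
From mathcomp Require Import ring.

Set Implicit Arguments.
Unset Strict Implicit.
Unset Printing Implicit Defensive.

Import Order.TTheory GRing.Theory Num.Theory.
Local Open Scope ring_scope.

(** Let [A] be an invertible combination of the slices whose coefficient vector
    [a] is orthogonal to no [w_i] (possible after extending [K] to [K(X)] and
    perturbing [A]; ranks can only increase).  A decomposition then gives
    [M_k = A^-1 T_k = P X_k Q] with [P Q = 1] and diagonal [X_k], i.e. in a basis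
    adapted to [Q P + G F = 1] the commuting matrices [X_k] extend the [M_k] by
    blocks [B_k = P X_k G], [C_k = F X_k Q], [D_k = F X_k G], and
    [[M_k, M_l] = B_l C_k - B_k C_l].  This bounds the commutator ranks, hence
    [r] from below.  For one triple satisfying (H_r) the [B]'s have independent
    columns and pairs of [C]'s independent rows, so the [M_k] determine all blocks
    up to one common change of basis [S].  Two decompositions are therefore
    conjugate by some [N] with [X_k N = N X'_k]; as the [w_i] are pairwise
    independent, [N] is monomial, and this matches the rank-one terms. *)

(** * Compressions of commuting matrices *)

(** The idempotent [1 - Q P] has a rank factorization [G F]; cancelling [G] on the left and [F] on
    the right yields the remaining identities. *)
Lemma mulmx1_complement (K : fieldType) (n d r : nat)
    (P : 'M[K]_(n, r)) (Q : 'M[K]_(r, n)) :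
  (n + d = r)%N -> P *m Q = 1%:M ->
  exists (G : 'M[K]_(r, d)) (F : 'M[K]_(d, r)),
    [/\ Q *m P + G *m F = 1%:M, F *m G = 1%:M, P *m G = 0 & F *m Q = 0].
Proof.
move=> ndr PQ1; pose E := 1%:M - Q *m P.
have PE : P *m E = 0 by rewrite mulmxBr mulmx1 mulmxA PQ1 mul1mx subrr.
have EQ : E *m Q = 0 by rewrite mulmxBl mul1mx -mulmxA PQ1 mulmx1 subrr.
have EE : E *m E = E by rewrite {1}/E mulmxBl mul1mx -mulmxA PE mulmx0 subr0.
move: (col_base E) (row_base E) (col_base_full E) (row_base_free E)
  (mulmx_base E) => G F /row_fullP [G' G'G] /row_freeP [F' FF'] GF.
have FK (k : nat) (X : 'M_(k, \rank E)) : X *m F = 0 -> X = 0.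
  by move=> XF; rewrite -[X]mulmx1 -FF' mulmxA XF mul0mx.
have GK (k : nat) (X : 'M_(\rank E, k)) : G *m X = 0 -> X = 0.
  by move=> GX; rewrite -[X]mul1mx -G'G -mulmxA GX mulmx0.
have PG : P *m G = 0 by apply: FK; rewrite -mulmxA GF.
have FQ : F *m Q = 0 by apply: GK; rewrite mulmxA GF.
have FG : F *m G = 1%:M.
  apply/eqP; rewrite -subr_eq0; apply/eqP/FK/GK.
  by rewrite mulmxBl mul1mx mulmxBr !mulmxA GF -mulmxA GF EE subrr.
have QPGF : Q *m P + G *m F = 1%:M by rewrite GF addrC subrK.
(* [col_mx P F] and [row_mx Q G] multiply to the identity in both orders, so [n + \rank E] and [r]
   bound each other. *)
have rkE : \rank E = d.
  apply/eqP; rewrite -(eqn_add2l n) ndr eqn_leq; apply/andP; split.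
    apply: (@mulmx1_min _ _ _ (col_mx P F) (row_mx Q G)).
    by rewrite mul_col_row PQ1 PG FQ FG -scalar_mx_block.
  by apply: (@mulmx1_min _ _ _ (row_mx Q G) (col_mx P F)); rewrite mul_row_col.
by case: d / rkE ndr => _; exists G, F.
Qed.

(** Writing the inner [Q P] as [1 - G F] makes a product of compressions the compression of the
    product minus a term through the complement; commutativity cancels the compressed products. *)
Lemma mxcommutator_compression (K : fieldType) (n d r : nat)
    (P : 'M[K]_(n, r)) (Q : 'M[K]_(r, n)) (G : 'M[K]_(r, d)) (F : 'M[K]_(d, r))
    (X Y : 'M[K]_r) :
  Q *m P + G *m F = 1%:M -> X *m Y = Y *m X ->
  mxcommutator (P *m X *m Q) (P *m Y *m Q) =
  (P *m Y *m G) *m (F *m X *m Q) - (P *m X *m G) *m (F *m Y *m Q).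
Proof.
move=> /(canRL (addrK _)) QP XY.
have step Z1 Z2 : P *m Z1 *m Q *m (P *m Z2 *m Q) =
    P *m (Z1 *m Z2) *m Q - (P *m Z1 *m G) *m (F *m Z2 *m Q).
  rewrite !mulmxA -(mulmxA _ Q P) QP mulmxBr mulmx1 !mulmxBl.
  by rewrite !mulmxA.
by rewrite /mxcommutator !step XY opprB addrC addrA subrK.
Qed.

Lemma mxrank_mxcommutator_compression (K : fieldType) (n r : nat)
    (P : 'M[K]_(n, r)) (Q : 'M[K]_(r, n)) (X Y : 'M[K]_r) :
  P *m Q = 1%:M -> X *m Y = Y *m X ->
  (\rank (mxcommutator (P *m X *m Q) (P *m Y *m Q)) <= (r - n).*2)%N.
Proof.
move=> PQ1 XY.
have [G [F [QP _ _ _]]] := mulmx1_complement (subnKC (mulmx1_min PQ1)) PQ1.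
rewrite (mxcommutator_compression QP XY) -addnn.
apply: leq_trans (mxrank_add _ _) _; rewrite mxrank_opp.
by apply: leq_add; apply: leq_trans (mxrankM_maxl _ _) (rank_leq_col _).
Qed.

(** * Recovering the off-diagonal blocks from the commutators *)

(** The difference factors through [col_mx C1 C2], so its rank makes those [2d] rows independent; a
    right inverse is then cut into two blocks. *)
Lemma right_inverse_of_rank (K : fieldType) (n d : nat)
    (B1 B2 : 'M[K]_(n, d)) (C1 C2 : 'M[K]_(d, n)) :
  (d.*2 <= \rank (B1 *m C1 - B2 *m C2)%R)%N ->
  exists R1 R2 : 'M[K]_(n, d),
    [/\ C1 *m R1 = 1%:M, C1 *m R2 = 0, C2 *m R1 = 0 & C2 *m R2 = 1%:M].
Proof.
rewrite -mulNmx -mul_row_col -addnn => /leq_trans/(_ (mxrankM_maxr _ _)) rk.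
have /row_freeP [R] : row_free (col_mx C1 C2).
  by rewrite /row_free eqn_leq rank_leq_row.
rewrite -[R]hsubmxK mul_col_row scalar_mx_block => /eq_block_mx [? ? ? ?].
by exists (lsubmx R), (rsubmx R).
Qed.

(** Both blocks factor through the [3d] columns of [B1], [B2], [B3], which the rank makes
    independent; a left inverse is cut into three blocks. *)
Lemma left_inverse_of_rank (K : fieldType) (n d : nat)
    (B1 B2 B3 : 'M[K]_(n, d)) (C1 C2 C3 C4 : 'M[K]_(d, n)) :
  (3 * d <= \rank (row_mx (B2 *m C1 - B1 *m C2)%R (B3 *m C3 - B1 *m C4)%R))%N ->
  exists L1 L2 L3 : 'M[K]_(d, n),
    [/\ L1 *m B1 = 1%:M, L1 *m B2 = 0 & L1 *m B3 = 0] /\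
    [/\ L2 *m B1 = 0, L2 *m B2 = 1%:M & L2 *m B3 = 0] /\
    [/\ L3 *m B1 = 0, L3 *m B2 = 0 & L3 *m B3 = 1%:M].
Proof.
have -> : row_mx (B2 *m C1 - B1 *m C2) (B3 *m C3 - B1 *m C4) =
    row_mx B1 (row_mx B2 B3) *m
    row_mx (col_mx (- C2) (col_mx C1 0)) (col_mx (- C4) (col_mx 0 C3)).
  rewrite mul_mx_row !mul_row_col !mulmx0 !mulmxN addr0 add0r.
  by rewrite ![- _ + _]addrC.
move=> /leq_trans/(_ (mxrankM_maxl _ _)); rewrite !mulSn mul0n addn0 => rk.
have /row_fullP [L] : row_full (row_mx B1 (row_mx B2 B3)).
  by rewrite /row_full eqn_leq rank_leq_col.
rewrite -[L]vsubmxK -[dsubmx L]vsubmxK mul_col_row scalar_mx_block.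
case/eq_block_mx; rewrite mul_mx_row -row_mx0 mul_col_mx -col_mx0 mul_col_row.
rewrite scalar_mx_block.
move=> L1B1 /eq_row_mx [L1B2 L1B3] /eq_col_mx [L2B1 L3B1] /eq_block_mx [? ? ? ?].
by exists (usubmx L), (usubmx (dsubmx L)), (dsubmx (dsubmx L)).
Qed.

(** Multiplying by [R2] and by [R3] expresses [B1'] through [B1], [B2] and through [B1], [B3]. The
    second expression is killed by [L], while [L] reads off the [B2] coefficient in the first, so
    that coefficient vanishes. *)
Lemma factor_through_common (K : fieldType) (n d : nat)
    (B1 B2 B3 B1' B2' B3' : 'M[K]_(n, d)) (C1 C2 C3 C1' C2' C3' : 'M[K]_(d, n))
    (L : 'M[K]_(d, n)) (R2 R3 : 'M[K]_(n, d)) :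
  B2 *m C1 - B1 *m C2 = B2' *m C1' - B1' *m C2' ->
  B3 *m C1 - B1 *m C3 = B3' *m C1' - B1' *m C3' ->
  L *m B1 = 0 -> L *m B2 = 1%:M -> L *m B3 = 0 ->
  C1' *m R2 = 0 -> C2' *m R2 = 1%:M -> C1' *m R3 = 0 -> C3' *m R3 = 1%:M ->
  exists S : 'M[K]_d, B1' = B1 *m S.
Proof.
move=> E12 E13 LB1 LB2 LB3 C1R2 C2R2 C1R3 C3R3.
have B1'_12 : B1' = B1 *m (C2 *m R2) - B2 *m (C1 *m R2).
  have := congr1 (mulmx^~ R2) E12; rewrite !mulmxBl -!mulmxA C1R2 C2R2.
  by rewrite mulmx0 mulmx1 sub0r => /(canLR opprK) <-; rewrite opprB.
have B1'_13 : B1' = B1 *m (C3 *m R3) - B3 *m (C1 *m R3).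
  have := congr1 (mulmx^~ R3) E13; rewrite !mulmxBl -!mulmxA C1R3 C3R3.
  by rewrite mulmx0 mulmx1 sub0r => /(canLR opprK) <-; rewrite opprB.
have LB1' : L *m B1' = 0.
  by rewrite B1'_13 mulmxBr !mulmxA LB1 LB3 !mul0mx subrr.
have C1R20 : C1 *m R2 = 0.
  have := LB1'; rewrite B1'_12 mulmxBr !(mulmxA L) LB1 LB2 mul0mx mul1mx sub0r.
  by move/eqP; rewrite oppr_eq0 => /eqP.
by exists (C2 *m R2); rewrite B1'_12 C1R20 mulmx0 subr0.
Qed.

Lemma cofactor_of_factor (K : fieldType) (n d : nat)
    (B1 B2 : 'M[K]_(n, d)) (C1 C2 C1' C2' L : 'M[K]_(d, n)) (S1 S2 : 'M[K]_d) :
  B2 *m C1 - B1 *m C2 = B2 *m S2 *m C1' - B1 *m S1 *m C2' ->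
  L *m B1 = 0 -> L *m B2 = 1%:M -> C1 = S2 *m C1'.
Proof.
move=> E LB1 LB2; have := congr1 (mulmx L) E.
by rewrite !mulmxBr !mulmxA LB1 LB2 !mul0mx !mul1mx !subr0.
Qed.

(* The lower bounds contained in (H_r), with [d = r - n], are all that is used;
   unlike (H_r) itself they survive a generic perturbation. *)
Definition large_commutators (K : fieldType) (n d : nat) (X Y W : 'M[K]_n) :=
  [/\ (d.*2 <= \rank (mxcommutator X Y))%N,
      (d.*2 <= \rank (mxcommutator X W))%N,
      (d.*2 <= \rank (mxcommutator Y W))%N &
      (3 * d <= \rank (row_mx (mxcommutator X Y) (mxcommutator X W)))%N].

(** Each [Bi'] is [Bi] times some [Si]; comparing the resulting formulas for the same [C1] or [C2]
    identifies the three factors. *)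
Lemma common_change_of_basis (K : fieldType) (n d : nat)
    (B1 B2 B3 B1' B2' B3' : 'M[K]_(n, d))
    (C1 C2 C3 C1' C2' C3' : 'M[K]_(d, n)) :
  B2 *m C1 - B1 *m C2 = B2' *m C1' - B1' *m C2' ->
  B3 *m C1 - B1 *m C3 = B3' *m C1' - B1' *m C3' ->
  B3 *m C2 - B2 *m C3 = B3' *m C2' - B2' *m C3' ->
  (d.*2 <= \rank (B2 *m C1 - B1 *m C2)%R)%N ->
  (d.*2 <= \rank (B3 *m C1 - B1 *m C3)%R)%N ->
  (d.*2 <= \rank (B3 *m C2 - B2 *m C3)%R)%N ->
  (3 * d <= \rank (row_mx (B2 *m C1 - B1 *m C2)%R (B3 *m C1 - B1 *m C3)%R))%N ->
  exists2 S : 'M[K]_d, S \in unitmx &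
    [/\ B1' = B1 *m S, B2' = B2 *m S, C1 = S *m C1' & C2 = S *m C2'].
Proof.
move=> E12 E13 E23 rk12 rk13 rk23.
move=> /left_inverse_of_rank [L1 [L2 [L3
  [[L11 L12 L13] [[L21 L22 L23] [L31 L32 L33]]]]]].
have [R [_ [C1R _ _ _]]] := right_inverse_of_rank rk12.
move: rk12 rk13 rk23; rewrite E12 E13 E23.
move=> /right_inverse_of_rank [R12 [R21 [C1R12 C1R21 C2R12 C2R21]]].
move=> /right_inverse_of_rank [R13 [R31 [C1R13 C1R31 C3R13 C3R31]]].
move=> /right_inverse_of_rank [R23 [R32 [C2R23 C2R32 C3R23 C3R32]]].
(* The sign-swapped identities let each of the three indices take the first place in
   [factor_through_common]. *)
have E21 : B1 *m C2 - B2 *m C1 = B1' *m C2' - B2' *m C1'.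
  by rewrite -opprB E12 opprB.
have E31 : B1 *m C3 - B3 *m C1 = B1' *m C3' - B3' *m C1'.
  by rewrite -opprB E13 opprB.
have E32 : B2 *m C3 - B3 *m C2 = B2' *m C3' - B3' *m C2'.
  by rewrite -opprB E23 opprB.
have [S1 eB1] := factor_through_common E12 E13 L21 L22 L23 C1R21 C2R21 C1R31 C3R31.
have [S2 eB2] := factor_through_common E21 E23 L12 L11 L13 C2R12 C1R12 C2R32 C3R32.
have [S3 eB3] := factor_through_common E31 E32 L13 L11 L12 C3R13 C1R13 C3R23 C2R23.
rewrite eB1 eB2 in E12 E21; rewrite eB1 eB3 in E13; rewrite eB2 eB3 in E23.
have C12 := cofactor_of_factor E12 L21 L22.
have C13 := cofactor_of_factor E13 L31 L33.
have C21 := cofactor_of_factor E21 L12 L11.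
have C23 := cofactor_of_factor E23 L32 L33.
(* [C1'] and [C2'] have right inverses, so they can be cancelled from [S2 C1' = S3 C1'] and
   [S1 C2' = S3 C2']. *)
have S23 : S2 = S3.
  by rewrite -[S2]mulmx1 -[S3]mulmx1 -C1R12 !mulmxA -C12 -C13.
have S13 : S1 = S3.
  by rewrite -[S1]mulmx1 -[S3]mulmx1 -C2R21 !mulmxA -C21 -C23.
exists S3; last by rewrite eB1 eB2 S13 S23.
by apply: (mulmx1_unit (B := C1' *m R) _).1; rewrite mulmxA -C13.
Qed.

(** Two indices transformed by [S] determine all others: the defects [a] of [C k] and [b] of [B k]
    satisfy [B l a = b C l] for [l = x, y], and the one-sided inverses force both to vanish. *)
Lemma common_change_of_basis_extend (K : fieldType) (I : Type) (n d : nat)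
    (B B' : I -> 'M[K]_(n, d)) (C C' : I -> 'M[K]_(d, n)) (x y : I)
    (S : 'M[K]_d) (Ly : 'M[K]_(d, n)) (R : 'M[K]_(n, d)) :
  (forall k l, B l *m C k - B k *m C l = B' l *m C' k - B' k *m C' l) ->
  S \in unitmx ->
  B' x = B x *m S -> C x = S *m C' x -> B' y = B y *m S -> C y = S *m C' y ->
  Ly *m B x = 0 -> Ly *m B y = 1%:M -> C x *m R = 1%:M ->
  forall k, B' k = B k *m S /\ C k = S *m C' k.
Proof.
move=> eBC uS Bx Cx By Cy LyBx LyBy CxR k.
pose a := C k - S *m C' k; pose b := B k - B' k *m invmx S.
have ab l : B' l = B l *m S -> C l = S *m C' l -> B l *m a = b *m C l.
  move=> Bl Cl; rewrite mulmxBr mulmxBl mulmxA -Bl [X in _ *m X *m C l]lock.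
  rewrite {2}Cl -lock mulmxA mulmxKV //.
  move/(canRL (subrK _)): (eBC k l) => ->.
  by rewrite addrAC (addrC _ (- (B' k *m _))) addrK addrC.
have bx := ab x Bx Cx; have by_ := ab y By Cy.
have Lyb : Ly *m b = 0.
  by rewrite -[LHS]mulmx1 -CxR mulmxA -(mulmxA Ly) -bx mulmxA LyBx !mul0mx.
have a0 : a = 0.
  by rewrite -[a]mul1mx -LyBy -mulmxA by_ mulmxA Lyb mul0mx.
have b0 : b = 0.
  by rewrite -[b]mulmx1 -CxR mulmxA -bx a0 mulmx0 mul0mx.
move/eqP: a0; move/eqP: b0; rewrite !subr_eq0 => /eqP -> /eqP ->.
by rewrite mulmxKV.
Qed.

(** * Uniqueness of the commuting extension *)

Lemma block_defect_eq (K : fieldType) (n d : nat) (M1 M2 : 'M[K]_n)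
    (B1 B2 : 'M[K]_(n, d)) (D1 D2 D1' D2' S : 'M[K]_d) :
  M1 *m B2 + B1 *m D2 = M2 *m B1 + B2 *m D1 ->
  M1 *m (B2 *m S) + B1 *m S *m D2' = M2 *m (B1 *m S) + B2 *m S *m D1' ->
  B1 *m (D2 *m S - S *m D2') = B2 *m (D1 *m S - S *m D1').
Proof.
move=> /(congr1 (mulmx^~ S)); rewrite !mulmxDl !mulmxBr !mulmxA => E E'.
have := congr2 (fun U V : 'M_(n, d) => U - V) E E'.
by rewrite /= opprD addrACA subrr add0r opprD addrACA subrr add0r.
Qed.

(** Commutators fix the blocks [B] and [C] up to [S]; commutativity of the [X k] then fixes the
    blocks [D]. In the adapted bases [N] is block diagonal with blocks [1] and [S]. *)
Lemma commuting_extension_unique (K : fieldType) (I : Type) (n d r : nat)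
    (P P' : 'M[K]_(n, r)) (Q Q' : 'M[K]_(r, n)) (X X' : I -> 'M[K]_r)
    (x y z : I) :
  let M k := P *m X k *m Q in
  (n + d = r)%N -> P *m Q = 1%:M -> P' *m Q' = 1%:M ->
  (forall k l, X k *m X l = X l *m X k) ->
  (forall k l, X' k *m X' l = X' l *m X' k) ->
  (forall k, M k = P' *m X' k *m Q') ->
  large_commutators d (M x) (M y) (M z) ->
  exists2 N : 'M[K]_r, N \in unitmx &
    [/\ P' = P *m N, Q = N *m Q' & forall k, X k *m N = N *m X' k].
Proof.
move=> M ndr PQ PQ' comX comX' eM.
have [G [F [QP FG PG FQ]]] := mulmx1_complement ndr PQ.
have [G' [F' [QP' FG' PG' FQ']]] := mulmx1_complement ndr PQ'.
pose B k := P *m X k *m G; pose C k := F *m X k *m Q; pose D k := F *m X k *m G.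
pose B' k := P' *m X' k *m G'; pose C' k := F' *m X' k *m Q'.
pose D' k := F' *m X' k *m G'.
have comE k l : mxcommutator (M k) (M l) = B l *m C k - B k *m C l.
  exact: mxcommutator_compression.
have comE' k l : mxcommutator (M k) (M l) = B' l *m C' k - B' k *m C' l.
  by rewrite !eM; apply: mxcommutator_compression.
have eBC k l : B l *m C k - B k *m C l = B' l *m C' k - B' k *m C' l.
  by rewrite -comE comE'.
rewrite /large_commutators !comE => -[rkxy rkxz rkyz rkxyz].
have [S uS [Bx By Cx Cy]] := common_change_of_basis (eBC x y) (eBC x z) (eBC y z)
  rkxy rkxz rkyz rkxyz.
have [Lx [Ly [_ [[LxBx LxBy _] [[LyBx LyBy _] _]]]]] := left_inverse_of_rank rkxyz.
have [R [_ [CxR _ _ _]]] := right_inverse_of_rank rkxy.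
have eB_eC :=
  common_change_of_basis_extend eBC uS Bx Cx By Cy LyBx LyBy CxR.
have eB k : B' k = B k *m S by have [] := eB_eC k.
have eC k : C k = S *m C' k by have [] := eB_eC k.
(* This is the upper right block of [X k X l = X l X k]. *)
have MBD k l : M k *m B l + B k *m D l = M l *m B k + B l *m D k.
  have step i j : M i *m B j + B i *m D j = P *m (X i *m X j) *m G.
    rewrite /M /B /D !mulmxA -(mulmxA _ Q P) -(mulmxA _ G F) -mulmxDl.
    by rewrite -mulmxDl -mulmxDr QP mulmx1.
  by rewrite !step comX.
have MBD' k l : M k *m B' l + B' k *m D' l = M l *m B' k + B' l *m D' k.
  have step i j : M i *m B' j + B' i *m D' j = P' *m (X' i *m X' j) *m G'.
    rewrite eM /B' /D' !mulmxA -(mulmxA _ Q' P') -(mulmxA _ G' F') -mulmxDl.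
    by rewrite -mulmxDl -mulmxDr QP' mulmx1.
  by rewrite !step comX'.
pose g k := D k *m S - S *m D' k.
have Bg k l : B k *m g l = B l *m g k.
  by apply: block_defect_eq (MBD k l) _; rewrite -!eB; apply: MBD'.
(* The relation [Bg] is used twice: with [y] it gives [g x = 0], and then with [x] it gives
   [g k = 0] for every [k]. *)
have gx : g x = 0.
  by rewrite -[g x]mul1mx -LyBy -mulmxA Bg mulmxA LyBx mul0mx.
have eD k : D k *m S = S *m D' k.
  apply/eqP; rewrite -subr_eq0 -/(g k); apply/eqP.
  by rewrite -[g k]mul1mx -LxBx -mulmxA Bg gx !mulmx0.
exists (Q *m P' + G *m S *m F').
  apply: (mulmx1_unit (B := Q' *m P + G' *m invmx S *m F) _).1.
  rewrite mulmxDr !mulmxDl !mulmxA.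
  rewrite -(mulmxA _ P' Q') PQ' -(mulmxA _ F' Q') FQ' -(mulmxA _ P' G') PG'.
  by rewrite -(mulmxA _ F' G') FG' !mulmx1 !mulmx0 !mul0mx addr0 add0r mulmxK.
split=> [||k].
- by rewrite mulmxDr !mulmxA PQ PG mul1mx !mul0mx addr0.
- by rewrite mulmxDl -!mulmxA PQ' FQ' mulmx1 !mulmx0 addr0.
(* Inserting the two resolutions of the identity on the outside reduces the intertwining relation to
   the four blocks. *)
transitivity ((Q *m P + G *m F) *m (X k *m (Q *m P' + G *m S *m F'))).
  by rewrite QP mul1mx.
transitivity (((Q *m P' + G *m S *m F') *m X' k) *m (Q' *m P' + G' *m F'));
  last by rewrite QP' mulmx1.
have -> : (Q *m P + G *m F) *m (X k *m (Q *m P' + G *m S *m F')) =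
    Q *m M k *m P' + Q *m (B k *m S) *m F' +
    (G *m C k *m P' + G *m (D k *m S) *m F').
  by rewrite /M /B /C /D mulmxDl !mulmxDr !mulmxA.
rewrite -eB eC eD eM /B' /C' /D'.
by rewrite mulmxDr !mulmxDl !mulmxA addrACA.
Qed.

(** * Diagonal extensions and matching of the rank-one terms *)

Lemma row_unitmx_neq0 (K : fieldType) (n : nat) (N : 'M[K]_n) (i : 'I_n) :
  N \in unitmx -> exists j, N i j != 0.
Proof.
move=> uN; apply/existsP/contraT => /existsPn Ni0.
have : delta_mx 0 i *m N = 0 :> 'rV_n.
  by rewrite -rowE; apply/rowP=> j; rewrite !mxE; apply/eqP/negPn/Ni0.
move/(congr1 (mulmx^~ (invmx N))); rewrite mulmxK // mul0mx.
by move/rowP/(_ i)/eqP; rewrite !mxE !eqxx oner_eq0.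
Qed.

(** A nonzero entry [N i j] forces [x i = x' j]. Picking one in every row gives a map that is
    injective because the [x i] are distinct, hence a permutation, whose inverse is [s]. *)
Lemma diagonal_intertwiner_monomial (K : fieldType) (I : Type) (r : nat)
    (x x' : 'I_r -> I -> K) (N : 'M[K]_r) :
  N \in unitmx ->
  (forall i j, (forall k, x i k = x j k) -> i = j) ->
  (forall k, diag_mx (\row_i x i k) *m N = N *m diag_mx (\row_i x' i k)) ->
  exists s : 'S_r,
    (forall j k, x' j k = x (s j) k) /\ (forall i j, N i j != 0 -> i = s j).
Proof.
move=> uN x_inj xN.
have eqx i j : N i j != 0 -> forall k, x i k = x' j k.
  move=> Nij k; apply: (mulIf Nij); have /matrixP/(_ i j) := xN k.
  by rewrite mul_diag_mx mul_mx_diag !mxE => ->; apply: mulrC.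
have [g Ng] := fin_all_exists (fun i => row_unitmx_neq0 i uN).
have g_inj : injective g.
  move=> i j gij; apply: x_inj => k.
  by rewrite (eqx _ _ (Ng i)) gij -(eqx _ _ (Ng j)).
have xs j k : x' j k = x ((perm g_inj)^-1%g j) k.
  by rewrite (eqx _ _ (Ng _)) -(permE g_inj) permKV.
exists (perm g_inj)^-1%g; split=> // i j Nij.
by apply: x_inj => k; rewrite -xs (eqx _ _ Nij).
Qed.

(** Since [A = U diag(e) V], moving [invmx A] and the weights [e] into [P] gives [P V = 1]; the
    [k]-th weights must then be divided by [e]. *)
Lemma decomposition_compression (K : fieldType) (I : finType) (n r : nat)
    (U : 'M[K]_(n, r)) (V : 'M[K]_(r, n)) (w : 'I_r -> I -> K) (a : I -> K) :
  let M k := U *m diag_mx (\row_i w i k) *m V in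
  let A := \sum_k a k *: M k in
  let e i := \sum_k a k * w i k in
  let P := invmx A *m U *m diag_mx (\row_i e i) in
  A \in unitmx -> (forall i, e i != 0) ->
  P *m V = 1%:M /\
  (forall k, P *m diag_mx (\row_i (w i k / e i)) *m V = invmx A *m M k).
Proof.
move=> M A e P uA e0; split=> [|k].
  have eA : A = U *m diag_mx (\row_i e i) *m V.
    have -> : diag_mx (\row_i e i) = \sum_k a k *: diag_mx (\row_i w i k).
      apply/matrixP=> i j; rewrite summxE mxE mxE -sumrMnl.
      by apply: eq_bigr => k _; rewrite !mxE mulrnAr.
    rewrite mulmx_sumr mulmx_suml; apply: eq_bigr => k _.
    by rewrite -scalemxAr -scalemxAl.
  by rewrite /P -!mulmxA [U *m _]mulmxA -eA mulVmx.
rewrite /P /M !mulmxA -[_ *m diag_mx _ *m diag_mx _]mulmxA mulmx_diag.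
congr (_ *m diag_mx _ *m _); apply/rowP=> i; rewrite !mxE.
by rewrite mulrC divfK.
Qed.

Lemma decomposition_rank_bound (K : fieldType) (I : finType) (n d r : nat)
    (U : 'M[K]_(n, r)) (V : 'M[K]_(r, n)) (w : 'I_r -> I -> K) (a : I -> K)
    (x y z : I) :
  let M k := U *m diag_mx (\row_i w i k) *m V in
  let A := \sum_k a k *: M k in
  A \in unitmx -> (forall i, \sum_k a k * w i k != 0) ->
  large_commutators d (invmx A *m M x) (invmx A *m M y) (invmx A *m M z) ->
  (n + d <= r)%N.
Proof.
move=> M A uA e0 [+ _ _ _].
have [PV MP] := decomposition_compression uA e0; rewrite -!MP.
rewrite -leq_subRL ?(mulmx1_min PV) // => rk; rewrite -leq_double.
apply: leq_trans rk _.
exact: mxrank_mxcommutator_compression (diag_mxC _ _).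
Qed.

Lemma decomposition_terms_unique (K : fieldType) (I : finType) (n d r : nat)
    (U U' : 'M[K]_(n, r)) (V V' : 'M[K]_(r, n)) (w w' : 'I_r -> I -> K)
    (a : I -> K) (x y z : I) :
  let M k := U *m diag_mx (\row_i w i k) *m V in
  let A := \sum_k a k *: M k in
  (n + d = r)%N ->
  (forall k, M k = U' *m diag_mx (\row_i w' i k) *m V') ->
  A \in unitmx ->
  (forall i, \sum_k a k * w i k != 0) -> (forall i, \sum_k a k * w' i k != 0) ->
  (forall i j c, (forall k, w i k = c * w j k) -> i = j) ->
  large_commutators d (invmx A *m M x) (invmx A *m M y) (invmx A *m M z) ->
  exists s : 'S_r, forall i b c k,
    U' b i * V' i c * w' i k = U b (s i) * V (s i) c * w (s i) k.
Proof.
move=> M A ndr eM uA e0 e0' w_indep.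
have [PV MP] := decomposition_compression uA e0.
have eA : A = \sum_k a k *: (U' *m diag_mx (\row_i w' i k) *m V').
  by apply: eq_bigr => k _; rewrite eM.
have uA' := uA; rewrite eA in uA'.
have [PV' MP'] := decomposition_compression uA' e0'.
rewrite -eA in PV' MP'.
set e := fun i => \sum_k a k * w i k in e0 PV MP.
set e' := fun i => \sum_k a k * w' i k in e0' PV' MP'.
rewrite -!MP => large.
have comX (x0 : 'I_r -> I -> K) k l :
    diag_mx (\row_i x0 i k) *m diag_mx (\row_i x0 i l) =
    diag_mx (\row_i x0 i l) *m diag_mx (\row_i x0 i k) := diag_mxC _ _.
have eMP k := etrans (MP k) (etrans (congr1 _ (eM k)) (esym (MP' k))).
have [N uN [PN VN XN]] := commuting_extension_unique ndr PV PV'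
  (comX (fun i k => w i k / e i)) (comX (fun i k => w' i k / e' i)) eMP large.
have [s [ws Ns]] : exists s : 'S_r,
    (forall j k, w' j k / e' j = w (s j) k / e (s j)) /\
    (forall i j, N i j != 0 -> i = s j).
  apply: diagonal_intertwiner_monomial uN _ XN => i j wij.
  (* Equal ratios to [e] make [w i] and [w j] proportional with factor [e i / e j]. *)
  apply: (w_indep i j (e i / e j)) => k.
  by rewrite -[LHS](divfK (e0 i)) wij mulrC mulrA mulrAC.
exists s => i b c k.
(* Only the entry [N (s i) i] survives in column [i] and in row [s i] of [N], so [U] and [V] change
   by that one scalar. *)
have Us : U' b i * e' i = U b (s i) * e (s i) * N (s i) i.
  have UN : U' *m diag_mx (\row_i e' i) = U *m diag_mx (\row_i e i) *m N.
    by move/(congr1 (mulmx A)): PN; rewrite !mulmxA !mulmxV // !mul1mx.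
  have /matrixP/(_ b i) := UN; rewrite mul_mx_diag !mxE => ->.
  rewrite (bigD1 (s i)) //= big1 => [|j ji]; first by rewrite addr0 mul_mx_diag !mxE.
  have [-> | /Ns jE] := eqVneq (N j i) 0; first by rewrite mulr0.
  by rewrite jE eqxx in ji.
have Vs : V (s i) c = N (s i) i * V' i c.
  rewrite VN mxE (bigD1 i) //= big1 ?addr0 // => j ji.
  have [-> | /Ns /perm_inj ij] := eqVneq (N (s i) j) 0; first by rewrite mul0r.
  by rewrite ij eqxx in ji.
have ws' : w' i k = e' i * (w (s i) k / e (s i)).
  by rewrite -ws mulrCA divff ?mulr1 //; apply: e0'.
(* The scalar [N (s i) i] passes from the [U] factor to the [V] factor, and the weights [e (s i)]
   cancel. *)
transitivity (U' b i * e' i * V' i c * (w (s i) k / e (s i))).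
  by rewrite ws'; ring.
by rewrite Us Vs; field; apply: e0.
Qed.

(** * Specialization and generic combinations of slices *)

(** One-sided inverses of the rank factors of the evaluated matrix compress [M] to a square [N] that
    evaluates to [1] at [c]. Hence [\det N] is a nonzero polynomial and stays nonzero under the
    injective [phi]. *)
Lemma mxrank_horner_le (K L : fieldType) (phi : {rmorphism {poly K} -> L})
    (m n : nat) (M : 'M[{poly K}]_(m, n)) (c : K) :
  injective phi ->
  (\rank (map_mx (horner_eval c) M) <= \rank (map_mx phi M))%N.
Proof.
move=> phi_inj; set M0 := map_mx _ M.
have /row_fullP [P PM] := col_base_full M0.
have /row_freeP [R MR] := row_base_free M0.
pose N := map_mx polyC P *m M *m map_mx polyC R.
have evC k l (B : 'M[K]_(k, l)) : map_mx (horner_eval c) (map_mx polyC B) = B.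
  by apply/matrixP=> i j; rewrite !mxE /horner_eval hornerC.
have N1 : map_mx (horner_eval c) N = 1%:M.
  rewrite !map_mxM !evC -/M0 -[X in P *m X *m R](mulmx_base M0).
  by rewrite mulmxA PM mul1mx MR.
have uN : map_mx phi N \in unitmx.
  rewrite unitmxE det_map_mx unitfE -(rmorph0 phi) (inj_eq phi_inj).
  apply/eqP => detN.
  have := det_map_mx (horner_eval c) N; rewrite N1 det1 detN rmorph0.
  by move/eqP; rewrite oner_eq0.
rewrite -[X in (X <= _)%N](mxrank_unit uN) !map_mxM.
by apply: leq_trans (mxrankM_maxl _ _) (mxrankM_maxr _ _).
Qed.

(** The adjugate replaces the inverse so that entries stay polynomial; the cost is a scalar, which
    is nonzero and leaves ranks unchanged. *)
Lemma mxcommutator_adj (K : fieldType) (n : nat) (A X Y : 'M[K]_n) :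
  A \in unitmx ->
  \adj A *m X *m (\adj A *m Y) - \adj A *m Y *m (\adj A *m X) =
  (\det A ^+ 2) *: mxcommutator (invmx A *m X) (invmx A *m Y).
Proof.
move=> uA; have -> : \adj A = \det A *: invmx A.
  by rewrite /invmx uA scalerA divff ?scale1r // -unitfE -unitmxE.
by rewrite -!scalemxAl -!scalemxAr !scalerA -scalerBr -expr2.
Qed.

Lemma large_commutators_specialization (K L : fieldType)
    (phi : {rmorphism {poly K} -> L}) (n d : nat) (A : 'M[{poly K}]_n)
    (c : K) (X Y W : 'M[K]_n) :
  let A0 := map_mx (horner_eval c) A in
  let A1 := map_mx phi A in
  let lift X := map_mx (phi \o polyC) X in
  injective phi -> A0 \in unitmx ->
  large_commutators d (invmx A0 *m X) (invmx A0 *m Y) (invmx A0 *m W) ->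
  A1 \in unitmx /\
  large_commutators d (invmx A1 *m lift X) (invmx A1 *m lift Y)
    (invmx A1 *m lift W).
Proof.
move=> A0 A1 lift phi_inj uA0.
have uA1 : A1 \in unitmx.
  rewrite -row_full_unit -col_leq_rank.
  by apply: leq_trans (mxrank_horner_le _ c phi_inj); rewrite mxrank_unit.
have d0 : \det A0 ^+ 2 != 0 by rewrite expf_neq0 // -unitfE -unitmxE.
have d1 : \det A1 ^+ 2 != 0 by rewrite expf_neq0 // -unitfE -unitmxE.
pose com X Y := let B := \adj A in let P := map_mx polyC in
  B *m P X *m (B *m P Y) - B *m P Y *m (B *m P X).
have com0 B1 B2 : map_mx (horner_eval c) (com B1 B2) =
    \det A0 ^+ 2 *: mxcommutator (invmx A0 *m B1) (invmx A0 *m B2).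
  have evC (B : 'M[K]_n) : map_mx (horner_eval c) (map_mx polyC B) = B.
    by apply/matrixP=> i j; rewrite !mxE /horner_eval hornerC.
  by rewrite -mxcommutator_adj // map_mxB !map_mxM !map_mx_adj !evC.
have com1 B1 B2 : map_mx phi (com B1 B2) =
    \det A1 ^+ 2 *: mxcommutator (invmx A1 *m lift B1) (invmx A1 *m lift B2).
  by rewrite -mxcommutator_adj // map_mxB !map_mxM !map_mx_adj -!map_mx_comp.
have rk1 k B1 B2 :
    (k <= \rank (mxcommutator (invmx A0 *m B1) (invmx A0 *m B2)))%N ->
    (k <= \rank (mxcommutator (invmx A1 *m lift B1) (invmx A1 *m lift B2)))%N.
  rewrite -(mxrank_scale_nz _ d0) -com0 -(mxrank_scale_nz _ d1) -com1.
  by move/leq_trans; apply; apply: mxrank_horner_le.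
case=> rkXY rkXW rkYW rkXYW; split=> //; split; [exact: rk1..|].
rewrite -(mxrank_scale_nz _ d1) scale_row_mx -!com1 -map_row_mx.
apply: leq_trans (mxrank_horner_le _ c phi_inj).
by rewrite map_row_mx !com0 -scale_row_mx mxrank_scale_nz.
Qed.

(** A rank is nonnegative, so the first integer equation forces [n <= r], after which the integer
    difference is the natural one. *)
Lemma large_commutators_propertyH (K : fieldType) (n r : nat) (X Y W : 'M[K]_n) :
  propertyH r X Y W -> (n <= r)%N /\ large_commutators (r - n) X Y W.
Proof.
rewrite /propertyH /colspace !mxrank_tr => -[[eXY eXW eYW] [eXYW _ _]].
have nr : (n <= r)%N.
  by rewrite -lez_nat -subr_ge0 -(pmulr_rge0 _ (isT : 0 < 2 :> int)) -eXY.
move: eXY eXW eYW eXYW; rewrite (subzn nr) => -[eXY] [eXW] [eYW] [eXYW].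
split=> //; split; rewrite -?mul2n ?eXY ?eXW ?eYW //.
by rewrite -mxrank_tr tr_row_mx -addsmxE eXYW.
Qed.

Lemma slice_spanP (K : fieldType) (n p : nat) (T : tensor K n n p) (A : 'M[K]_n) :
  A \in slice_span T -> exists a : 'I_p -> K, A = \sum_k a k *: slice T k.
Proof.
move=> AT; have {}AT : A \in <<[tuple slice T k | k < p]>>%VS by [].
exists (fun k => coord [tuple slice T k | k < p] k A); rewrite {1}(coord_span AT).
by apply: eq_bigr => k _; rewrite -tnth_nth tnth_mktuple.
Qed.

Lemma poly_field_embedding (K : fieldType) :
  exists (L : fieldType) (phi : {rmorphism {poly K} -> L}), injective phi.
Proof.
exists {fraction {poly K}}, (@tofrac {poly K}) => f g.
by move/eqP; rewrite tofrac_eq => /eqP.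
Qed.

(* The coefficients [a k + X^(k+1)] in K(X) specialise to those of [A] at 0,
   and no nonzero vector over K is orthogonal to them. *)
Lemma generic_slice_combination (K : fieldType) (n p d : nat)
    (T : tensor K n n p) (A : 'M[K]_n) (x y z : 'I_p) :
  A \in slice_span T -> A \in unitmx ->
  large_commutators d (invmx A *m slice T x) (invmx A *m slice T y)
    (invmx A *m slice T z) ->
  exists (L : fieldType) (iota : {rmorphism K -> L}) (a : 'I_p -> L),
    let M k := map_mx iota (slice T k) in
    let B := \sum_k a k *: M k in
    [/\ B \in unitmx,
        forall w : 'cV[K]_p, w != 0 -> \sum_k a k * iota (w k 0) != 0 &
        large_commutators d (invmx B *m M x) (invmx B *m M y) (invmx B *m M z)].
Proof.
move=> /slice_spanP [a eA] uA large.
pose q k := (a k)%:P + 'X^(k.+1).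
pose Aq : 'M[{poly K}]_n := \sum_k q k *: map_mx polyC (slice T k).
have Aq0 : map_mx (horner_eval 0) Aq = A.
  rewrite eA map_mx_sum; apply: eq_bigr => k _; rewrite map_mxZ -map_mx_comp.
  apply/matrixP=> i j; rewrite !mxE /= /horner_eval.
  by rewrite /q hornerD !hornerC hornerXn expr0n addr0.
rewrite -Aq0 in uA large.
have [L [phi phi_inj]] := poly_field_embedding K.
have [uB {}large] := large_commutators_specialization phi_inj uA large.
exists L, (phi \o polyC), (fun k => phi (q k)).
have Aq1 : map_mx phi Aq =
    \sum_k phi (q k) *: map_mx (phi \o polyC) (slice T k).
  by rewrite map_mx_sum; apply: eq_bigr => k _; rewrite map_mxZ -map_mx_comp.
rewrite /= -Aq1; split=> // w /eqP w0.
have [l wl] : exists l, w l 0 != 0.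
  apply/existsP; apply: contra_notT w0 => /existsPn w0.
  by apply/colP=> k; rewrite mxE; apply/eqP/negPn/w0.
under eq_bigr do rewrite /= -rmorphM.
(* In degree [l + 1] the constants [a k] do not contribute and only ['X^(l.+1)] does, so the
   coefficient is [w l 0]. *)
rewrite -rmorph_sum -(rmorph0 phi) (inj_eq phi_inj); apply: contra wl => /eqP/polyP/(_ l.+1).
rewrite coef0 coef_sum (bigD1 l) //= big1 => [|k kl].
  by rewrite addr0 coefMC coefD coefC coefXn eqxx add0r mul1r => ->.
by rewrite coefMC coefD coefC coefXn eqSS val_eqE (eq_sym l) (negPf kl) addr0 mul0r.
Qed.

(** * Application to tensors *)

Lemma slice_sum_outer (K : fieldType) (m n p s : nat)
    (u : 'I_s -> 'cV[K]_m) (v : 'I_s -> 'cV[K]_n) (w : 'I_s -> 'cV[K]_p) (k : 'I_p) :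
  slice (\sum_(i < s) outer (u i) (v i) (w i)) k =
  (\matrix_(b, i) u i b 0) *m diag_mx (\row_i w i k 0) *m (\matrix_(i, c) v i c 0).
Proof.
apply/matrixP=> b c; rewrite mxE sum_ffunE !mxE; apply: eq_bigr => i _.
by rewrite ffunE mul_mx_diag !mxE /= mulrAC.
Qed.

Lemma map_decomposed_slice (K L : fieldType) (f : {rmorphism K -> L}) (m n p s : nat)
    (u : 'I_s -> 'cV[K]_m) (v : 'I_s -> 'cV[K]_n) (w : 'I_s -> 'cV[K]_p) (k : 'I_p) :
  map_mx f (slice (\sum_(i < s) outer (u i) (v i) (w i)) k) =
  map_mx f (\matrix_(b, i) u i b 0) *m diag_mx (\row_i f (w i k 0)) *m
  map_mx f (\matrix_(i, c) v i c 0).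
Proof.
rewrite slice_sum_outer !map_mxM map_diag_mx; congr (_ *m diag_mx _ *m _).
by apply/rowP=> i; rewrite !mxE.
Qed.

(** The bound is obtained over the extension [L], where the generic coefficients are orthogonal to
    no [w i]. *)
Lemma tensor_rank_lower_bound (K : fieldType) (n p d s : nat)
    (u v : 'I_s -> 'cV[K]_n) (w : 'I_s -> 'cV[K]_p) (A : 'M[K]_n) (x y z : 'I_p) :
  let T := \sum_(i < s) outer (u i) (v i) (w i) in
  A \in slice_span T -> A \in unitmx ->
  large_commutators d (invmx A *m slice T x) (invmx A *m slice T y)
    (invmx A *m slice T z) ->
  (forall i, w i != 0) -> (n + d <= s)%N.
Proof.
move=> T AT uA large w0.
have [L [f [a [uB wB {}large]]]] := generic_slice_combination AT uA large.
have eT k := map_decomposed_slice f u v w k.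
have eB : \sum_k a k *: map_mx f (slice T k) =
    \sum_k a k *: (_ *m diag_mx _ *m _) :=
  eq_bigr _ (fun k _ => congr1 (fun M => a k *: M) (eT k)).
rewrite eB in uB large; rewrite !eT in large.
exact: decomposition_rank_bound uB (fun i => wB _ (w0 i)) large.
Qed.

(** The terms are matched over the extension [L]; the equalities descend to [K] because field
    morphisms are injective. *)
Lemma outer_terms_unique (K : fieldType) (n p d r : nat)
    (u v u' v' : 'I_r -> 'cV[K]_n) (w w' : 'I_r -> 'cV[K]_p)
    (A : 'M[K]_n) (x y z : 'I_p) :
  let T := \sum_(i < r) outer (u i) (v i) (w i) in
  T = \sum_(i < r) outer (u' i) (v' i) (w' i) ->
  (n + d = r)%N ->
  (forall i j, i != j -> free [:: w i; w j]) ->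
  A \in slice_span T -> A \in unitmx ->
  large_commutators d (invmx A *m slice T x) (invmx A *m slice T y)
    (invmx A *m slice T z) ->
  (forall i, w i != 0) -> (forall i, w' i != 0) ->
  exists s : 'S_r, forall i,
    outer (u' i) (v' i) (w' i) = outer (u (s i)) (v (s i)) (w (s i)).
Proof.
move=> T eT' ndr w_free AT uA large w0 w'0.
have [L [f [a [uB wB {}large]]]] := generic_slice_combination AT uA large.
have eT k := map_decomposed_slice f u v w k.
have eB : \sum_k a k *: map_mx f (slice T k) =
    \sum_k a k *: (_ *m diag_mx _ *m _) :=
  eq_bigr _ (fun k _ => congr1 (fun M => a k *: M) (eT k)).
rewrite eB in uB large; rewrite !eT in large.
have eTT' k := etrans (esym (eT k))
  (etrans (congr1 (fun T => map_mx f (slice T k)) eT')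
    (map_decomposed_slice f u' v' w' k)).
have w_indep i j (c : L) : (forall k, f (w i k 0) = c * f (w j k 0)) -> i = j.
  move=> wij; apply/eqP; apply: contraT => /w_free.
  rewrite free_cons span_seq1 => /andP [/negP wNij _]; case: wNij.
  (* A coordinate where [w j] is nonzero shows that the factor [c], a priori in [L], comes from a
     quotient in [K]. *)
  have /matrix0Pn [k [l]] := w0 j; rewrite (ord1 l) => wjk.
  apply/vlineP; exists (w i k 0 / w j k 0); apply/colP=> b; rewrite mxE.
  by apply: (fmorph_inj f); rewrite rmorphM fmorph_div !wij mulfK ?fmorph_eq0.
have [s es] := decomposition_terms_unique ndr eTT' uB (fun i => wB _ (w0 i))
  (fun i => wB _ (w'0 i)) w_indep large.
exists s => i; apply/ffunP => -[[b c] k]; rewrite !ffunE /=; apply: (fmorph_inj f).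
by rewrite !rmorphM; have := es i b c k; rewrite !mxE.
Qed.

Lemma rank_one_outer (K : fieldType) (m n p : nat)
    (u : 'cV[K]_m) (v : 'cV[K]_n) (w : 'cV[K]_p) :
  outer u v w != 0 -> [/\ u != 0, v != 0 & w != 0].
Proof.
move=> uvw; split; apply: contraNneq uvw => ->; apply/eqP/ffunP => x;
  by rewrite !ffunE !mxE ?(mul0r, mulr0).
Qed.

Lemma decomposition_outer (K : fieldType) (m n p s : nat)
    (T : tensor K m n p) (t : 'I_s -> tensor K m n p) :
  decomposition T t -> exists (u : 'I_s -> 'cV[K]_m) (v : 'I_s -> 'cV[K]_n)
    (w : 'I_s -> 'cV[K]_p),
    (forall i, t i = outer (u i) (v i) (w i)) /\ (forall i, w i != 0).
Proof.
case=> /fin_all_exists [u /fin_all_exists [v /fin_all_exists [w uvw]]] _.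
by exists u, v, w; split=> i; case: (uvw i).
Qed.

Theorem theorem4p3 (K : fieldType) (n p r : nat)
  (hn : (0 < n)%N) (hp : (4 <= p)%N) (hr : (0 < r)%N)
  (u v : 'I_r -> 'cV[K]_n) (w : 'I_r -> 'cV[K]_p)
  (T : tensor K n n p)
  (hT : T = \sum_(i < r) outer (u i) (v i) (w i))
  (hw : forall i j : 'I_r, i != j -> free [:: w i; w j])
  (hinv : exists2 B : 'M[K]_n, B \in slice_span T & B \in unitmx)
  (hH : exists A : 'M[K]_n,
      [/\ A \in slice_span T, A \in unitmx &
          forall l : 'I_p, (2 <= l)%N ->
          exists m : 'I_p, [/\ (2 <= m)%N, m != l &
            propertyH r (invmx A *m slice T (second_index hp))
                        (invmx A *m slice T l)
                        (invmx A *m slice T m)]]) :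
  has_tensor_rank T r /\ essentially_unique_decomposition T r.
Proof.
have [A [AT uA H]] := hH.
have [z [_ _ /large_commutators_propertyH [nr large]]] :=
  H (Ordinal (leq_trans (isT : 2 < 4)%N hp)) isT.
have rank_ge s (t : 'I_s -> tensor K n n p) : decomposition T t -> (r <= s)%N.
  move=> dec; have [u' [v' [w' [et w'0]]]] := decomposition_outer dec.
  have eT : T = \sum_(i < s) outer (u' i) (v' i) (w' i).
    by rewrite dec.2; apply: eq_bigr => i _; rewrite et.
  rewrite -(subnKC nr); rewrite eT in AT large.
  exact: tensor_rank_lower_bound AT uA large w'0.
pose t i := outer (u i) (v i) (w i).
(* The given terms may a priori vanish. Dropping the zero ones leaves a decomposition of length
   [#|J|], and the lower bound [r] then forces [J] to be everything. *)
have t0 i : t i != 0.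
  pose J := [set i | t i != 0].
  have decJ : decomposition T (fun i : 'I_#|J| => t (enum_val i)).
    split=> [j|].
      have := enum_valP j; rewrite inE => /rank_one_outer [? ? ?].
      by exists (u (enum_val j)), (v (enum_val j)), (w (enum_val j)).
    rewrite hT -(big_enum_val t) big_mkcond [RHS]big_mkcond /=.
    by apply: eq_bigr => j _; rewrite inE; case: eqP.
  have /eqP JT : J == setT.
    by rewrite eqEcard subsetT cardsT card_ord (rank_ge _ _ decJ).
  by have := in_setT i; rewrite -JT inE.
have t1 i : [/\ u i != 0, v i != 0 & w i != 0] := rank_one_outer (t0 i).
have dect : decomposition T t.
  by split=> // i; exists (u i), (v i), (w i); have [] := t1 i.
split; first by split; [exists t | apply: rank_ge].
exists t => // t' dec'; have [u' [v' [w' [et' w'0]]]] := decomposition_outer dec'.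
have eT : T = \sum_(i < r) outer (u' i) (v' i) (w' i).
  by rewrite dec'.2; apply: eq_bigr => i _; rewrite et'.
rewrite hT in AT large eT.
have w0 i : w i != 0 by have [] := t1 i.
have [s es] := outer_terms_unique eT (subnKC nr) hw AT uA large w0 w'0.
by exists s => i; rewrite et' es.
Qed.
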